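(* Let $(X,T)$ be a t.d.s. and let $n\ge1$. Then $(X,T)$ has the marker property if and only if $(X,T^n)$ has the marker property.
   Context: A t.d.s. $(X,T)$ is a compact metrizable space $X$ with a homeomorphism $T:X\to X$. $(X,T)$ has the marker property if for every finite set $F\subset\mathbb{Z}\setminus\{0\}$ there is an open set $U\subset X$ such that $X=\bigcup_{m\in\mathbb{Z}}T^mU$ and $U\cap T^mU=\emptyset$ for all $m\in F$. *)

(* Defs.v *)
From mathcomp Require Import all_boot all_order all_algebra.
From mathcomp Require Import all_classical all_reals all_analysis.

Set Implicit Arguments.
Unset Strict Implicit.
Unset Printing Implicit Defensive.

Local Open Scope classical_set_scope.

Definition homeomorphism {X Y : topologicalType} (f : X -> Y) : Prop :=
  exists g : Y -> X,
    [/\ cancel f g, cancel g f, continuous f & continuous g].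

Definition metrizable (R : realType) (X : topologicalType) : Prop :=
  exists (M : metricType R) (f : X -> M), homeomorphism f.

(* [R] is the type of values of the metric. [X] may be empty. *)
Definition tds (R : realType) (X : topologicalType) (T : X -> X) : Prop :=
  [/\ compact [set: X], metrizable R X & homeomorphism T].

(* T^m U for m : int. [Negz k] is -(k+1), and for bijective T the image of U
   under T^-(k+1) is the preimage of U under T^(k+1). *)
Definition iterz_image {X : Type} (T : X -> X) (m : int) (U : set X) : set X :=
  match m with
  | Posz k => iter k T @` U
  | Negz k => iter k.+1 T @^-1` U
  end.

Definition marker_property {X : topologicalType} (T : X -> X) : Prop :=
  forall F : set int, finite_set F -> ~ F 0%R ->
    exists U : set X,
      [/\ open U,
          [set: X] = \bigcup_(m in [set: int]) iterz_image T m U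
        & forall m : int, F m -> U `&` iterz_image T m U = set0].

(* Main.v *)
(** Call a set N-separated if no point returns to it at times 1, .., N.

    From T to T^n: if U is (nN + n)-separated under T, then the union of
    U, T^-1 U, .., T^-(n-1) U is N-separated under T^n.

    From T^n to T: let V be a marker for T^n, L-separated under T^n with L huge,
    and shrink it by compactness to markers V = A_0, A_1, .. with
    cl A_(k+1) inside A_k. Put M_k = A_(k+1) minus the points that hit cl A_k
    within the times 1, .., L; it lies in a closed set that is L-separated
    under T. If an orbit avoided M_0, .., M_(2n-1), a point of A_(2n) on it
    would start a chain of n + 1 visits to V with gaps at most L. Two of their
    times agree mod n, so V has a return under T^n at some time at most L, which
    is absurd. Hence the orbits of finitely many M_k, their number depending
    only on n, cover X. They are merged one at a time, each merge losing only a
    constant factor of separation. *)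

Require Import Defs.
From mathcomp Require Import all_boot all_order all_algebra.
From mathcomp Require Import all_classical all_reals all_analysis.
From mathcomp Require Import zify.

Set Implicit Arguments.
Unset Strict Implicit.
Unset Printing Implicit Defensive.

Local Open Scope classical_set_scope.
Local Open Scope nat_scope.

(** * Orbits and separated sets *)

(** For bijective [T] this is lying on the same two-sided orbit, expressed by forward iterates
    only. *)
Definition orbit_rel {X : Type} (T : X -> X) (x y : X) : Prop :=
  exists k l, iter k T x = iter l T y.

Definition orbits_meet {X : Type} (T : X -> X) (U : set X) (x : X) : Prop :=
  exists2 y, U y & orbit_rel T x y.

Definition avoid {X : Type} (T : X -> X) (a b : nat) (C : set X) : set X :=
  [set x | forall j, a <= j <= b -> ~ C (iter j T x)].

Definition separated {X : Type} (T : X -> X) (N : nat) (U : set X) : Prop :=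
  U `<=` avoid T 1 N U.

Section Orbits.
Context {X : Type} (T : X -> X).

Lemma orbit_rel_iter k x : orbit_rel T x (iter k T x).
Proof. by exists k, 0. Qed.

Lemma orbit_rel_trans y x z :
  orbit_rel T x y -> orbit_rel T y z -> orbit_rel T x z.
Proof.
move=> [k [l E]] [a [b F]]; exists (a + k), (l + b).
by rewrite iterD E -iterD addnC iterD F -iterD.
Qed.

Lemma orbits_meet_rel U x y :
  orbit_rel T x y -> orbits_meet T U y -> orbits_meet T U x.
Proof. by move=> xy [z Uz yz]; exists z => //; apply: orbit_rel_trans yz. Qed.

Lemma separated_lt N U x i j : separated T N U -> i < j -> j <= i + N ->
  U (iter i T x) -> U (iter j T x) -> False.
Proof.
move=> sU ij jN Ui Uj; apply: (sU _ Ui (j - i)); first by lia.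
by rewrite -iterD subnK // ltnW.
Qed.

Lemma separated_sub M N U V :
  N <= M -> U `<=` V -> separated T M V -> separated T N U.
Proof.
by move=> NM UV sV x Ux j jN /UV; apply: sV; [exact: UV | lia].
Qed.

End Orbits.


Section Bijective.
Context {X : Type} (T g : X -> X).
Hypotheses (Tg : cancel T g) (gT : cancel g T).

Lemma iter_can k : cancel (iter k T) (iter k g).
Proof. by elim: k => // k IH x; rewrite iterSr /= Tg IH. Qed.

Lemma iter_can_sym k : cancel (iter k g) (iter k T).
Proof. by elim: k => // k IH x; rewrite iterSr /= gT IH. Qed.

Lemma orbits_meet_iterz U x :
  orbits_meet T U x <-> exists m, iterz_image T m U x.
Proof.
split=> [[y Uy [k [l E]]]|[[k|k] /=]]; last 2 first.
- by move=> [y Uy <-]; exists y => //; exists 0, k.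
- by move=> Ux; exists (iter k.+1 T x) => //; exists k.+1, 0.
have [kl|lk] := leqP k l.
  exists (Posz (l - k)); exists y => //; apply: (can_inj (iter_can k)).
  by rewrite -iterD subnKC.
exists (Negz (k - l).-1) => /=; rewrite -iterS prednK ?subn_gt0 //.
suff -> : iter (k - l) T x = y by [].
by apply: (can_inj (iter_can l)); rewrite -iterD subnKC // ltnW.
Qed.

End Bijective.

(** A finite [F] is bounded in absolute value by some [N], and a return at time [-k] is a return at
    time [k] seen from the other end, so positive times suffice. *)
Lemma marker_propertyP (X : topologicalType) (T g : X -> X) :
  cancel T g ->
  marker_property T <-> forall N, exists U,
    [/\ open U, forall x, orbits_meet T U x & separated T N U].
Proof.
move=> Tg; split=> [mT N|mT F finF F0].
  have [||U [oU cU sU]] := mT (Posz @` [set k | 0 < k <= N]).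
  - apply: finite_image; apply: (sub_finite_set _ (finite_II N.+1)).
    by move=> k /= /andP[_].
  - by move=> [[|k]] //= /andP[].
  exists U; split=> // [x|x Ux j jN Uj].
    apply/(orbits_meet_iterz Tg); have : [set: X] x by [].
    by rewrite cU => -[m _ ?]; exists m.
  have : (U `&` iterz_image T (Posz j) U) (iter j T x).
    by split=> //; exists x.
  by rewrite sU //; exists j.
have [s Fs] := (finite_seqP F).1 finF.
have [U [oU cU sU]] := mT (\max_(m <- s) absz m).
have sN m : F m -> absz m <= \max_(m <- s) absz m.
  by rewrite Fs => ms; apply: leq_bigmax_seq.
exists U; split=> // [|m Fm].
  apply/seteqP; split=> // x _.
  by have [m] := (orbits_meet_iterz Tg U x).1 (cU x); exists m.
apply/seteqP; split=> // x; case: m Fm => k Fm /= [Ux].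
  move=> [y Uy yx]; apply: (sU _ Uy k); last by rewrite yx.
  have := sN _ Fm; rewrite /= => ->; rewrite andbT lt0n.
  by apply: contra_notN F0 => /eqP k0; move: Fm; rewrite k0.
by move=> Ukx; apply: (sU _ Ux k.+1) => //; have := sN _ Fm.
Qed.

(** * Continuity, compactness and regularity *)

Lemma continuous_iter (X : topologicalType) (T : X -> X) k :
  continuous T -> continuous (iter k T).
Proof.
move=> cT; elim: k => [|k IH] x; first exact: cvg_id.
by apply: (@continuous_comp _ _ _ (iter k T) T x); [exact: IH|exact: cT].
Qed.

Section Topology.
Context {X : topologicalType} (T : X -> X).
Hypothesis cT : continuous T.

Lemma open_iter k U : open U -> open (iter k T @^-1` U).
Proof. by apply: open_comp => x _; apply: continuous_iter. Qed.

Lemma open_avoid a b C : closed C -> open (avoid T a b C).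
Proof.
move=> cC; rewrite -closedC.
suff -> : ~` avoid T a b C =
    \bigcup_(j in [set j | a <= j <= b]) (iter j T @^-1` C).
  apply: closed_bigcup => [|j _].
    apply: (sub_finite_set _ (finite_II b.+1)) => j /= /andP[_]; exact.
  by apply: preimage_closed => // x _; apply: continuous_iter.
apply/seteqP; split=> x.
  by move=> /existsNP[j /not_implyP[ab /contrapT Cj]]; exists j.
by move=> [j ab Cj] /(_ j ab).
Qed.

Lemma closed_avoid a b U : open U -> closed (avoid T a b U).
Proof.
move=> oU; suff -> : avoid T a b U =
    \bigcap_(j in [set j | a <= j <= b]) ~` (iter j T @^-1` U).
  by apply: closed_bigI => j _; apply: open_closedC; apply: open_iter.
by [].
Qed.

(** By regularity, near each [x] all orbits meet some open [W] with closure in [V]. Such [W] are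
    closed under finite unions, so compactness yields one [W] for all [x]. *)
Lemma shrink_marker g V :
  cancel T g -> cancel g T -> continuous g ->
  compact [set: X] -> regular_space X -> open V ->
  (forall x, orbits_meet T V x) ->
  exists W, [/\ open W, closure W `<=` V & forall x, orbits_meet T W x].
Proof.
move=> Tg gT cg cX rX oV mV.
pose D := [set W | open W /\ closure W `<=` V].
(* The filter of sufficiently large members of [D], along which the near-covering form of
   compactness is applied. *)
pose F := filter_from D (fun W => [set W' | D W' /\ W `<=` W']).
have FF : Filter F.
  apply: filter_from_filter.
    by exists set0; split; [exact: open0 | rewrite closure0].
  move=> W1 W2 [op1 c1] [op2 c2]; exists (W1 `|` W2).
    by split; [exact: openU | rewrite closureU subUset].
  by move=> W' [DO' s]; split; split=> // x ?; apply: s; [left|right].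
suff : F [set W | [set: X] `<=` orbits_meet T W].
  by move=> [W [oW cW] sW]; exists W; split=> // x; apply: (sW W) => //; split.
apply: ((compact_near_coveringP _).1 cX _ F (fun W x => orbits_meet T W x) FF).
move=> x _; have [y Vy [k [l xy]]] := mV x.
have [A nA cA] := rX y _ (open_nbhs_nbhs (conj oV Vy)).
exists (iter k T @^-1` (iter l g @^-1` A°), [set W' | D W' /\ A° `<=` W']).
  split=> /=.
    apply: open_nbhs_nbhs; split.
      apply: open_comp => [z _|]; first exact: continuous_iter.
      by apply: open_comp => [z _|]; [exact: continuous_iter|exact: open_interior].
    by rewrite /= xy (iter_can Tg).
  exists A°; last exact: subset_refl.
  split; first exact: open_interior.
  by apply: subset_trans cA; apply: closureS; exact: interior_subset.
move=> [z W] /= [Az [_ AW]]; exists (iter l g (iter k T z)); first exact: AW.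
by exists k, l; rewrite (iter_can gT).
Qed.

End Topology.

Lemma regular_homeomorphism (X Y : topologicalType) (f : X -> Y) :
  homeomorphism f -> regular_space Y -> regular_space X.
Proof.
move=> [g [fg gf cf cg]] rY x U Ux.
have [A nA cA] : exists2 A, nbhs (f x) A & closure A `<=` g @^-1` U.
  by apply: rY; apply: cg; rewrite /= fg.
exists (f @^-1` A); first exact: cf.
apply: (@subset_trans _ (f @^-1` closure A)).
  have cl : closed (f @^-1` closure A).
    by apply: preimage_closed => [z _|]; [exact: cf | exact: closed_closure].
  by rewrite ((closure_id _).1 cl); apply: closureS => z Az; exact: (@subset_closure _ A).
by move=> z /cA; rewrite /= fg.
Qed.

Lemma metrizable_regular (R : realType) (X : topologicalType) :
  metrizable R X -> regular_space X.
Proof.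
by move=> [M [f hf]]; apply: (regular_homeomorphism hf); exact: uniform_regular.
Qed.

(** * Merging separated sets *)

Section Combination.
Context {X : topologicalType} (T g : X -> X).
Hypotheses (cT : continuous T) (gT : cancel g T).

(* Up to a shift by N, every visit w to W may be represented by w itself or by
   its shift in time by h, and whatever comes within N of C is discarded.
   Discarding by the closed C keeps the result open, and since C is separated
   it can discard only one of the two representatives of w. *)
Lemma combine_separated N M C W :
  open M -> closed C -> M `<=` C -> separated T (4 * N).+1 C ->
  open W -> separated T (3 * N).+1 W ->
  exists U, [/\ open U, separated T N U &
    M `|` W `<=` orbits_meet T U].
Proof.
move=> oM cC MC sC oW sW.
(* The windows [0..2N] and [h..h+2N] are disjoint and together span [4N+1] steps. Visits to [W] from
   different representatives differ by [h+j] or [h-j] with [1 <= j <= N], hence by [1..3N+1]. *)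
pose h := (2 * N).+1; pose B := avoid T 0 (2 * N) C.
have oB : open B by exact: open_avoid.
exists ((iter N T @^-1` M) `|` (B `&` (iter N T @^-1` W))
        `|` (B `&` (iter (N + h) T @^-1` W))); split.
- by apply: openU; [apply: openU; last apply: openI | apply: openI] => //;
    apply: open_iter.
- move=> x Ux j /andP[j0 jN] Uj.
  have Bx i : B x -> i <= 2 * N -> ~ C (iter i T x) by move=> + i2 => /(_ i i2).
  have Bj i : B (iter j T x) -> i <= 2 * N -> ~ C (iter (i + j) T x).
    by move=> + i2 => /(_ i i2); rewrite iterD.
  move: Ux Uj; rewrite /setU /setI /preimage /= -!iterD.
  move=> [[Mx|[Bxx Wx]]|[Bxx Wx]] [[Mj|[Bjj Wj]]|[Bjj Wj]].
  + apply: (separated_lt sC _ _ (MC _ Mx) (MC _ Mj)); lia.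
  + apply: (Bj (N - j) Bjj); first by lia.
    by rewrite subnK //; exact: MC.
  + apply: (Bj (N - j) Bjj); first by lia.
    by rewrite subnK //; exact: MC.
  + apply: (Bx (N + j) Bxx); first by lia.
    exact: MC.
  + apply: (separated_lt sW _ _ Wx Wj); lia.
  + apply: (separated_lt sW _ _ Wx Wj); rewrite /h; lia.
  + apply: (Bx (N + j) Bxx); first by lia.
    exact: MC.
  + apply: (separated_lt sW _ _ Wj Wx); rewrite /h; lia.
  + apply: (separated_lt sW _ _ Wx Wj); rewrite /h; lia.
- move=> w; rewrite /setU /=.
  have pre k : iter k T (iter k g w) = w by exact: iter_can_sym.
  have rel k : orbit_rel T w (iter k g w) by exists 0, k; rewrite pre.
  case=> [Mw|Ww].
    exists (iter N g w); last exact: rel.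
    by left; left; rewrite /= pre.
  have [Bw|nBw] := pselect (B (iter N g w)).
    exists (iter N g w); last exact: rel.
    by left; right; split=> //=; rewrite pre.
  have [Bw|nBw'] := pselect (B (iter (N + h) g w)).
    exists (iter (N + h) g w); last exact: rel.
    by right; split=> //=; rewrite pre.
  move: nBw nBw' => /existsNP[i /not_implyP[iN /contrapT Ci]].
  move=> /existsNP[j /not_implyP[jN /contrapT Cj]]; exfalso.
  (* If both representatives are discarded, [C] is visited once in each window. *)
  have Ci' : C (iter (h + i) T (iter (N + h) g w)).
    move: Ci; rewrite (addnC N) [iter (h + N) g w]iterD (addnC h i) iterD.
    by rewrite iter_can_sym.
  apply: (separated_lt sC _ _ Cj Ci'); rewrite /h; lia.
Qed.

End Combination.

(** Induction on [k]: the first [k] sets are merged with separation [4N+1], and [4N+2 <= 5(N+1)]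
    explains the factor 5. *)
Lemma combine_family (X : topologicalType) (T g : X -> X) (L : nat)
    (M C : nat -> set X) (k N : nat) :
  continuous T -> cancel g T ->
  (forall i, open (M i)) -> (forall i, closed (C i)) ->
  (forall i, M i `<=` C i) -> (forall i, separated T L (C i)) ->
  5 ^ k * N.+1 <= L ->
  exists U, [/\ open U, separated T N U &
    forall i, i < k -> M i `<=` orbits_meet T U].
Proof.
move=> cT gT oM cC MC sC; elim: k N => [|k IH] N NL.
  by exists set0; split=> //; exact: open0.
have kN : 5 ^ k * (4 * N).+2 <= L.
  by apply: leq_trans NL; rewrite expnSr -mulnA leq_mul2l; lia.
have NL' : (4 * N).+1 <= L.
  by have : 0 < 5 ^ k by [rewrite expn_gt0]; nia.
have [W [oW sW cW]] := IH _ kN.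
have [|U [oU sU cU]] := combine_separated cT gT (oM k) (cC k) (MC k)
  (separated_sub NL' (@subset_refl _ _) (sC k)) oW (N := N).
  by apply: separated_sub sW => //; lia.
exists U; split=> // i; rewrite ltnS leq_eqVlt => /predU1P[->|ik] x Mx.
  by apply: cU; left.
have [y Wy xy] := cW i ik x Mx.
by apply: orbits_meet_rel xy _; apply: cU; right.
Qed.

(** * Passing between [T] and its [n]-th iterate *)

Section Power.
Context {X : topologicalType} (T g : X -> X) (n : nat).
Hypotheses (cT : continuous T) (gT : cancel g T) (n0 : 0 < n).

Lemma orbits_meet_power U x :
  orbits_meet (iter n T) U x -> orbits_meet T U x.
Proof.
move=> [y Uy [k [l E]]]; exists y => //; exists (k * n), (l * n).
by rewrite !iterM.
Qed.

Lemma power_marker N U :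
  open U -> (forall x, orbits_meet T U x) -> separated T (n * N + n) U ->
  exists V, [/\ open V, forall x, orbits_meet (iter n T) V x &
    separated (iter n T) N V].
Proof.
move=> oU cU sU; exists (\bigcup_(i in [set i | i < n]) iter i T @^-1` U).
split=> [|x|x [i /= i_n Ui] j jN [i' /= i'_n Ui']].
- by apply: bigcup_open => i _; exact: open_iter.
- have [y Uy [k [l E]]] := cU x.
  (* Applying [k * n - k] more steps makes the time of [x] a multiple of [n]. *)
  pose q := k * n - k + l.
  have {}E : iter (k * n) T x = iter q T y.
    by rewrite [RHS]iterD -E -iterD subnK // leq_pmulr.
  (* The quotient [q / n] rounded up; moving [y] back by fewer than [n] steps makes its time the
     multiple [b * n]. *)
  pose b := (q + n.-1) %/ n.
  have [qb bq] : q <= b * n /\ b * n < q + n.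
    have := divn_eq (q + n.-1) n; have := ltn_pmod (q + n.-1) n0.
    by rewrite -/b; move: (b * n) ((q + n.-1) %% n) => ? ?; lia.
  exists (iter (b * n - q) g y).
    by exists (b * n - q) => /=; [lia | rewrite (iter_can_sym gT)].
  exists k, b; rewrite -!iterM E -{1}(iter_can_sym gT (b * n - q) y) -iterD.
  by rewrite subnKC.
- move: Ui'; rewrite -iterM -iterD => Ui'.
  by apply: (separated_lt sU _ _ Ui Ui'); nia.
Qed.

(** Each link of the chain descends two levels: a visit to [V k.+2] forces one to the closure of
    [V k.+1], inside [V k]. So [n] links need [2 * n] levels. *)
Lemma power_marker_chain L (V : nat -> set X) y :
  (forall k, closure (V k.+1) `<=` V k) -> separated (iter n T) L (V 0) ->
  V (2 * n) y ->
  exists k t, k < 2 * n /\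
    (V k.+1 `&` avoid T 1 L (closure (V k))) (iter t T y).
Proof.
move=> clV sV Vy; apply: contrapT => noM.
(* [nx] gives the gap to the next visit from a pair of target level and current time. *)
have /choice[nx nxP] (p : nat * nat) : exists j, p.1.+1 < 2 * n ->
    V p.1.+2 (iter p.2 T y) -> 0 < j <= L /\ V p.1 (iter (p.2 + j) T y).
  case: p => k t /=.
  have [[k2n Vk]|nVk] := pselect (k.+1 < 2 * n /\ V k.+2 (iter t T y)); last first.
    by exists 0 => ? ?; case: nVk.
  have /existsNP[j /not_implyP[jL /contrapT clj]] :
      ~ avoid T 1 L (closure (V k.+1)) (iter t T y).
    by move=> av; apply: noM; exists k.+1, t.
  by exists j => _ _; split=> //; apply: clV; rewrite addnC iterD.
(* [f i] is the time of the [i]-th visit, which lies in [V (2 * (n - i))]. *)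
pose f := fix f i := if i is i'.+1 then f i' + nx (2 * (n - i'.+1), f i') else 0.
have step i : i < n -> V (2 * (n - i)) (iter (f i) T y) ->
    0 < nx (2 * (n - i.+1), f i) <= L /\
    V (2 * (n - i.+1)) (iter (f i.+1) T y).
  move=> i_n Vi; apply: (nxP (2 * (n - i.+1), f i)) => /=; first by lia.
  by have <- : 2 * (n - i) = (2 * (n - i.+1)).+2 by lia.
have Vf i : i <= n -> V (2 * (n - i)) (iter (f i) T y).
  elim: i => [_|i IH i_n]; first by rewrite subn0.
  by have [] := step i i_n (IH (ltnW i_n)).
have V0 k : V k `<=` V 0.
  by elim: k => // k IH x Vx; apply/IH/clV/subset_closure.
have lt_f i d : 0 < d -> i + d <= n -> f i < f (i + d) <= f i + d * L.
  elim: d => // -[|d] IH _ idn.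
    rewrite addn1 /=; have [||+ _] := step i _ (Vf i _); [lia|lia|].
    by move: (nx _) => ?; lia.
  have idn' : i + d.+1 < n by rewrite -addnS.
  have [+ _] := step _ idn' (Vf _ (ltnW idn')).
  move: (IH isT (ltnW idn')); rewrite (addnS i d.+1) [f (i + d.+1).+1]/=.
  move: (f (i + d.+1)) (nx _) (f i) => u v w /andP[? ?] /andP[? ?].
  by rewrite mulSn; apply/andP; split; lia.
pose c (i : 'I_n.+1) := Ordinal (ltn_pmod (f i) n0).
have c_lt (i j : 'I_n.+1) : i < j -> c i <> c j.
  move=> ij [] /eqP; rewrite eq_sym => E.
  have := lt_f i (j - i); rewrite subn_gt0 ij subnKC ?(ltnW ij) //.
  move=> /(_ isT (ltn_ord j)) /andP[lt_ij le_ij].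
  (* Equal residues give a return under [iter n T] at time [m]; at most [n] gaps of length at most
     [L] give [0 < m <= L]. *)
  have /dvdnP[m jm] : n %| f j - f i by rewrite -eqn_mod_dvd // ltnW.
  have fj : f j = m * n + f i by rewrite -jm subnK // ltnW.
  apply: (sV (iter (f i) T y) _ m).
  - by apply: V0; apply: Vf; have := ltn_ord i.
  - have jn := ltn_ord j.
    have : m * n <= n * L by apply: (@leq_trans ((j - i) * L)); nia.
    by nia.
  - by rewrite -iterM -iterD -fj; apply: V0; apply: Vf; have := ltn_ord j.
have /leq_card : injective c.
  move=> i j E; apply/val_inj; case: (ltngtP i j) => // ij.
    by case: (c_lt _ _ ij).
  by case: (c_lt _ _ ij).
by rewrite !card_ord ltnn.
Qed.

Lemma marker_of_power N V :
  cancel T g -> continuous g -> compact [set: X] -> regular_space X ->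
  open V -> (forall x, orbits_meet (iter n T) V x) ->
  separated (iter n T) (5 ^ (2 * n) * N.+1) V ->
  exists U, [/\ open U, forall x, orbits_meet T U x & separated T N U].
Proof.
set L := 5 ^ _ * _ => Tg cg cX rX oV cV sV.
(* Shrinking becomes a total function on sets, with default [set0], so that it can be iterated. *)
have /choice[sh shP] (W : set X) : exists W' : set X,
    open W -> (forall x, orbits_meet T W x) ->
    [/\ open W', closure W' `<=` W & forall x, orbits_meet T W' x].
  have [[oW cW]|nW] := pselect (open W /\ forall x, orbits_meet T W x).
    have [W' W'P] := shrink_marker cT Tg gT cg cX rX oW cW.
    by exists W'.
  by exists set0 => ? ?; case: nW.
pose A k := iter k sh V.
have [oA cA] : (forall k, open (A k)) /\ (forall k x, orbits_meet T (A k) x).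
  suff H k : open (A k) /\ (forall x, orbits_meet T (A k) x).
    by split=> k; case: (H k).
  elim: k => [|k [IHo IHc]]; last by case: (shP _ IHo IHc).
  by split=> // x; apply: orbits_meet_power.
have clA k : closure (A k.+1) `<=` A k by case: (shP _ (oA k) (cA k)).
pose M k := A k.+1 `&` avoid T 1 L (closure (A k)).
(* Moving the closure to the other factor turns the open [M k] into a closed superset. It is
   [L]-separated because a return to the closure of [A k.+1] is a visit to [A k]. *)
pose C k := closure (A k.+1) `&` avoid T 1 L (A k).
have [k|k|k x [Ax av]|k x [clx av] j jL [/clA Aj _]||U [oU sU cU]] :=
  @combine_family X T g L M C (2 * n) N cT gT.
- apply: openI => //; apply: open_avoid => //; exact: closed_closure.
- by apply: closedI; [exact: closed_closure | exact: closed_avoid].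
- split; first exact: subset_closure.
  by move=> j jL Aj; apply: (av j jL); exact: subset_closure.
- exact: (av j jL).
- by [].
exists U; split=> // x; have [y Ay xy] := cA (2 * n) x.
have [k [t [k2n Mt]]] := power_marker_chain clA sV Ay.
apply: orbits_meet_rel xy _; apply: orbits_meet_rel (orbit_rel_iter T t y) _.
exact: cU k2n _ Mt.
Qed.

End Power.

Theorem propositionB1 (R : realType) (X : topologicalType) (T : X -> X)
    (n : nat) (hT : tds R T) (hn : (1 <= n)%N) :
  marker_property T <-> marker_property (iter n T).
Proof.
case: hT => cX /metrizable_regular rX [g [Tg gT cT cg]].
rewrite (marker_propertyP Tg) (marker_propertyP (iter_can Tg n)).
split=> mT N.
  by have [U [oU cU sU]] := mT (n * N + n); apply: power_marker sU.
have [V [oV cV sV]] := mT (5 ^ (2 * n) * N.+1).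
exact: (marker_of_power cT gT hn Tg cg cX rX oV cV sV).
Qed.
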